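(* Let $X,Y$ be Banach spaces (both real or both complex), let $d\in\mathbb{N}$, and let $\alpha$ be a reasonable cross norm on $\otimes^dX$. (1) The map $\Psi:\mathcal{P}(^dX,Y)\to\mathcal{L}(\mathbb{V}^d_X;Y)$, $\Psi(P):=T_P|_{\mathbb{V}^d_X}$, is an isometric isomorphism, where $\mathbb{V}^d_X$ carries the metric $d_{s,\pi}$. If $\mathcal{L}(\mathbb{V}^d_X;Y)$ is replaced by $\mathcal{L}((\mathbb{V}^d_X,d_\alpha);Y)$, then $\Psi$ is an isomorphism (a linear bijection bounded in both directions). (2) The inclusion map $\varphi:\mathcal{L}((\mathbb{V}^d_X,d_\alpha),Y)\hookrightarrow Lip_0((\mathbb{V}^d_X,d_\alpha),Y)$ is an isometric linear inclusion.
   Context: A map $P:X\to Y$ is a $d$-homogeneous polynomial if $P(x)=T(x,\dots,x)$ for some continuous $d$-linear map $T$; $\mathcal{P}(^dX,Y)$ is the space of these with norm $\|P\|=\sup\{\|P(x)\|:\|x\|\le1\}$. $\otimes^dX$ is the algebraic $d$-fold tensor product and $\otimes^d_sX$ its subspace of symmetric tensors (the span of the $x\otimes\stackrel{d}{\cdots}\otimes x$), with norm $\|u\|_{s,\pi}=\inf\{\sum_i|\lambda_i|\,\|x_i\|^d:\ u=\sum_i\lambda_i\,x_i\otimes\stackrel{d}{\cdots}\otimes x_i \text{ (finite sum)},\ \lambda_i\text{ scalars},\ x_i\in X\}$ and completion $\hat\otimes^d_{s,\pi}X$. $T_P\in\mathcal{L}(\hat\otimes^d_{s,\pi}X,Y)$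 is the unique bounded linear operator with $P(x)=T_P(x\otimes\stackrel{d}{\cdots}\otimes x)$ for all $x$. $\mathbb{V}^d_X=\{x\otimes\stackrel{d}{\cdots}\otimes x:x\in X\}$, with $d_{s,\pi}$, $d_\alpha$ the metrics induced by $\|\cdot\|_{s,\pi}$ and $\alpha$. A map $f:\mathbb{V}^d_X\to Y$ is a $\mathbb{V}$-operator if $f=T|_{\mathbb{V}^d_X}$ for some $T\in\mathcal{L}(\hat\otimes^d_{s,\pi}X,Y)$. $\mathcal{L}(\mathbb{V}^d_X;Y)$ is the vector space of all $\mathbb{V}$-operators with the Lipschitz norm (best Lipschitz constant) with respect to $d_{s,\pi}$; $\mathcal{L}((\mathbb{V}^d_X,d_\alpha);Y)$ is the same vector space with the Lipschitz norm with respect to $d_\alpha$. For a metric space $M$ with base point $0$, $Lip_0(M,Y)$ is the space of Lipschitz maps $M\to Y$ vanishing at $0$ with the Lipschitz norm; the base point of $\mathbb{V}^d_X$ is the zero tensor. A norm $\alpha$ on $\otimes^dX$ is a reasonable cross norm if $\alpha(x_1\otimes\cdots\otimes x_d)\le\|x_1\|\cdots\|x_d\|$ for all $x_i\in X$, and for all $x_i^*\in X^*$ the functional $x_1^*\otimes\cdots\otimes x_d^*$ is $\alpha$-bounded with norm at most $\|x_1^*\|\cdots\|x_d^*\|$. *)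

(* Defs.v *)
(* Norms of spaces over K : numFieldType take values in K;
   for K = R[i] they are nonnegative, hence real, and the partial order of R[i]
   gives the usual suprema and infima of bounded nonempty sets of norms. *)
From HB Require Import structures.
From mathcomp Require Import all_boot all_order all_algebra.
From mathcomp Require Import all_classical all_reals all_analysis.

Set Implicit Arguments.
Unset Strict Implicit.
Unset Printing Implicit Defensive.

Import Order.TTheory GRing.Theory Num.Theory.
Import numFieldNormedType.Exports.

Local Open Scope classical_set_scope.
Local Open Scope ring_scope.

Section LinearSpan.
Context {K : numFieldType} {E : lmodType K} (S : set E).

Definition span : set E :=
  [set u | exists n (c : 'I_n -> K) (s : 'I_n -> E),
     (forall i, S (s i)) /\ u = \sum_(i < n) c i *: s i].

Definition span_mem : {pred E} := fun u => `[< span u >].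

Lemma span_submod_closed : submod_closed span_mem.
Proof.
split.
  by apply/asboolP; exists 0%N, (fun=> 0), (fun=> 0); split=> [[]//|]; rewrite big_ord0.
move=> a u v /asboolP[n [c [s [Ss ->]]]] /asboolP[m [e [t [St ->]]]].
apply/asboolP; exists (n + m)%N.
exists (fun i => match fintype.split i with inl j => a * c j | inr j => e j end).
exists (fun i => match fintype.split i with inl j => s j | inr j => t j end).
split=> [i|]; first by case: (fintype.split i).
rewrite big_split_ord /= scaler_sumr; congr (_ + _); apply: eq_bigr => i _.
  by rewrite (unsplitK (inl i)) scalerA.
by rewrite (unsplitK (inr i)).
Qed.

HB.instance Definition _ := GRing.isSubmodClosed.Build K E span_mem span_submod_closed.

Record span_type := SpanType { span_val : E; span_valP : span_mem span_val }.

HB.instance Definition _ := [isSub for span_val].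
HB.instance Definition _ := [Choice of span_type by <:].
HB.instance Definition _ := [SubChoice_isSubLmodule of span_type by <:].

Lemma span_mem_gen u : S u -> span_mem u.
Proof.
move=> Su; apply/asboolP; exists 1%N, (fun=> 1), (fun=> u); split=> //.
by rewrite big_ord1 scale1r.
Qed.

Definition span_gen u (Su : S u) : span_type := SpanType (span_mem_gen Su).

End LinearSpan.

Section Multilinear.
Context {K : numFieldType}.

Definition multilinear (d : nat) (X Y : lmodType K) (T : ('I_d -> X) -> Y) :=
  forall (x : 'I_d -> X) (i : 'I_d) (a : K) (u v : X),
    T (dfwith x i (a *: u + v)) =
    a *: T (dfwith x i u) + T (dfwith x i v).

Record mform (d : nat) (X : lmodType K) := MForm {
  mform_fun :> ('I_d -> X) -> K^o;
  mformP : multilinear mform_fun }.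

Lemma prod_multilinear (d : nat) (X : lmodType K) (f : 'I_d -> {linear X -> K^o}) :
  multilinear (fun x : 'I_d -> X => (\prod_(i < d) (f i (x i) : K)) : K^o).
Proof.
move=> x i a u v.
have E w : \prod_(j < d) (f j (dfwith x i w j) : K) =
           f i w * \prod_(j < d | j != i) (f j (x j) : K).
  rewrite (bigD1 i) //= dfwithin; congr (_ * _).
  by apply: eq_bigr => j ji; rewrite dfwithout // eq_sym.
rewrite !E; have -> : f i (a *: u + v) = a * f i u + f i v :> K by exact: linearP.
by rewrite mulrDl -mulrA.
Qed.

Definition prod_mform (d : nat) (X : lmodType K) (f : 'I_d -> {linear X -> K^o}) :=
  MForm (prod_multilinear f).

End Multilinear.

Section TensorPower.
Context {K : numFieldType} (d : nat) (X : lmodType K).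

(* The algebraic tensor power is realised as in Ryan's "Introduction to Tensor
   Products of Banach Spaces": x_1 (x) ... (x) x_d is the evaluation functional
   A |-> A(x_1, ..., x_d) on the space of all (algebraic) d-linear forms, and
   the tensor power is the linear span of these functionals. *)
Definition elementary (x : 'I_d -> X) : mform d X -> K^o := fun A => A x.

Definition tensor := span_type (range elementary).

Definition tens (x : 'I_d -> X) : tensor := span_gen (imageT elementary x).

(* x_1^* (x) ... (x) x_d^* evaluated at a tensor. *)
Definition tens_functional (f : 'I_d -> {linear X -> K^o}) (u : tensor) : K :=
  span_val u (prod_mform f).

Definition stensor := span_type (range (fun x : X => tens (fun=> x))).

Definition tpow (x : X) : stensor :=
  span_gen (imageT (fun x : X => tens (fun=> x)) x).

Definition stensor_val (u : stensor) : tensor := span_val u.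

Definition veronese : set stensor := range tpow.

Definition veronese_pow (x : X) : veronese := exist _ (tpow x) (mem_set (imageT tpow x)).

(* 0 (x) ... (x) 0 is the zero tensor only for d > 0: the zeroth power is 1. *)
Definition veronese0 : veronese := veronese_pow 0.

Lemma veronese0E : (0 < d)%N -> val veronese0 = 0.
Proof.
move=> d0; apply/val_inj/val_inj/funext => A /=.
rewrite /elementary.
have -> : (fun=> 0 : X) = dfwith (fun=> 0) (Ordinal d0) (0 : X).
  by apply/funext => j; rewrite /dfwith; case: eqP => // e; case: _ / e.
have := mformP A (fun=> 0) (Ordinal d0) (-1) 0 0.
by rewrite scaler0 addr0 scaleN1r addNr.
Qed.

End TensorPower.

Arguments veronese {K} d X _.
Arguments veronese0 {K} d X.

Section BanachTensor.
Context {K : numFieldType}.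

Definition sup_norm (X Y : normedModType K) (P : X -> Y) : K :=
  supremum 0 [set `|P x| | x in [set x : X | `|x| <= 1]].

Definition hpoly (d : nat) (X Y : normedModType K) : set (X -> Y) :=
  [set P | exists T : {ptws 'I_d -> X} -> Y,
     [/\ multilinear T, continuous T & forall x, P x = T (fun=> x)]].

Definition s_pi (d : nat) (X : normedModType K) (u : stensor d X) : K :=
  infimum 0 [set r | exists n (c : 'I_n -> K) (x : 'I_n -> X),
     u = \sum_(i < n) c i *: tpow d (x i) /\ r = \sum_(i < n) `|c i| * `|x i| ^+ d].

Record s_pi_completion (d : nat) (X : normedModType K) := SPiCompletion {
  compl_space :> completeNormedModType K;
  compl_inj : {linear stensor d X -> compl_space};
  compl_isometry : forall u, `|compl_inj u| = s_pi u;
  compl_dense : dense (range compl_inj) }.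

Record reasonable_cross_norm (d : nat) (X : normedModType K)
    (alpha : tensor d X -> K) : Prop := {
  rcn_ge0 : forall u, 0 <= alpha u;
  rcn_eq0 : forall u, alpha u = 0 -> u = 0;
  rcn_triangle : forall u v, alpha (u + v) <= alpha u + alpha v;
  rcn_scale : forall a u, alpha (a *: u) = `|a| * alpha u;
  rcn_tens : forall x, alpha (tens x) <= \prod_(i < d) `|x i|;
  rcn_functional : forall f : 'I_d -> {linear X -> K^o},
    (forall i, continuous (f i)) ->
    forall u, `|tens_functional f u| <= (\prod_(i < d) sup_norm (f i)) * alpha u }.

Definition dist_s_pi (d : nat) (X : normedModType K) (u v : veronese d X) : K :=
  s_pi (val u - val v).

Definition dist_of (d : nat) (X : normedModType K) (alpha : tensor d X -> K)
    (u v : veronese d X) : K :=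
  alpha (stensor_val (val u) - stensor_val (val v)).

(* A linear subspace of an ambient space (here always a space of functions)
   together with a norm; [nrm] is only meaningful on the carrier. *)
Record normed_sub (V : lmodType K) := NormedSub {
  carrier :> set V;
  nrm : V -> K }.

Definition linear_on (V W : lmodType K) (A : set V) (f : V -> W) :=
  forall (a : K) u v, A u -> A v -> f (a *: u + v) = a *: f u + f v.

Definition isometric_isomorphism (V W : lmodType K)
    (A : normed_sub V) (B : normed_sub W) (f : V -> W) :=
  [/\ linear_on A f, set_bij A B f & forall u, carrier A u -> nrm B (f u) = nrm A u].

Definition isomorphism (V W : lmodType K)
    (A : normed_sub V) (B : normed_sub W) (f : V -> W) :=
  [/\ linear_on A f, set_bij A B f,
      exists M : K, forall u, carrier A u -> nrm B (f u) <= M * nrm A u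
    & exists M : K, forall u, carrier A u -> nrm A u <= M * nrm B (f u)].

Definition isometric_inclusion (V W : lmodType K)
    (A : normed_sub V) (B : normed_sub W) (f : V -> W) :=
  [/\ linear_on A f, set_fun A B f, set_inj A f
    & forall u, carrier A u -> nrm B (f u) = nrm A u].

Definition lip_consts (M : Type) (Y : normedModType K) (dist : M -> M -> K)
    (f : M -> Y) : set K :=
  [set L | 0 <= L /\ forall u v, `|f u - f v| <= L * dist u v].

Definition lip_norm (M : Type) (Y : normedModType K) (dist : M -> M -> K)
    (f : M -> Y) : K := infimum 0 (lip_consts dist f).

Definition Lip0 (M : Type) (Y : normedModType K) (dist : M -> M -> K) (o : M) :
    normed_sub (M -> Y) :=
  NormedSub [set f | lip_consts dist f !=set0 /\ f o = 0] (lip_norm dist).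

Definition polySpace (d : nat) (X Y : normedModType K) : normed_sub (X -> Y) :=
  NormedSub (@hpoly d X Y) (@sup_norm X Y).

Section VOperators.
Context (d : nat) (X Y : normedModType K) (C : s_pi_completion d X).

Definition bounded_linear : set (C -> Y) := [set T | linear T /\ continuous T].

Definition restrict_veronese (T : C -> Y) : veronese d X -> Y :=
  fun v => T (compl_inj C (val v)).

Definition v_operator : set (veronese d X -> Y) :=
  [set f | exists2 T, bounded_linear T & f = restrict_veronese T].

Definition VSpace (dist : veronese d X -> veronese d X -> K) :
    normed_sub (veronese d X -> Y) :=
  NormedSub v_operator (lip_norm dist).

(* The operator T_P with P x = T_P (x (x) ... (x) x). *)
Definition linearization (P : X -> Y) : C -> Y :=
  xget 0 [set T | bounded_linear T /\ forall x, P x = T (compl_inj C (tpow d x))].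

Definition Psi (P : X -> Y) : veronese d X -> Y :=
  restrict_veronese (linearization P).

End VOperators.
End BanachTensor.

(* Main.v *)
(* A polynomial P with d-linear form T factors through the symmetric tensors:
   if sum_i c_i x_i^d = 0, every functional on Y composed with T is a d-linear
   form, so sum_i c_i P x_i is killed by all functionals and vanishes by
   Hahn-Banach.  The resulting linear map L satisfies |L u| <= |P| s_pi(u)
   straight from the definition of s_pi, hence extends to the completion; and
   any Lipschitz constant of L on the Veronese cone bounds |P| because
   d(x^d, 0) <= |x|^d.  Conversely an operator on the completion composed with
   the polarization of x |-> x^d is a continuous d-linear map.

   For alpha, the tensor x^d - y^d lives in the d-th power of span(x, y).
   Hahn-Banach gives coordinates f_0, f_1 on that plane of norm at most 2,
   uniformly in x and y; the products of the f_b are alpha-bounded, so the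
   coordinates of x^d - y^d are dominated by alpha(x^d - y^d), with a constant
   depending on d only. *)
Require Import Defs.
From HB Require Import structures.
From mathcomp Require Import all_boot all_order all_algebra.
From mathcomp Require Import all_classical all_reals all_analysis.
From mathcomp Require Import fingroup perm complex.
From mathcomp Require Import ring lra.

Set Implicit Arguments.
Unset Strict Implicit.
Unset Printing Implicit Defensive.

Import Order.TTheory GRing.Theory Num.Theory.
Import numFieldNormedType.Exports.

Local Open Scope classical_set_scope.
Local Open Scope ring_scope.

(** * Hahn-Banach theorem over R and R[i] *)

Definition sublinear (R : realType) (V : lmodType R) (q : V -> R) :=
  (forall u v, q (u + v) <= q u + q v) /\
  (forall (t : R) v, 0 <= t -> q (t *: v) = t * q v).

Lemma sublinear_ge (R : realType) (V : lmodType R) (q : V -> R) :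
  sublinear q -> forall u, - q (- u) <= q u.
Proof.
move=> [qD qZ] u; have := qD (- u) u.
by have := qZ 0 0 (lexx _); rewrite addNr scale0r mul0r => ->; lra.
Qed.

(** The parameter [t = 0] shows that the tilt lies below [q], and [t = 1] that its value at [- x] is
    at most [- q x]. A linear functional below the tilt is therefore at least [q x] at [x]. *)
Definition tilt (R : realType) (V : lmodType R) (q : V -> R) (x y : V) : R :=
  inf [set q (y + t *: x) - t * q x | t in [set t | 0 <= t]].

Section Tilt.
Context (R : realType) (V : lmodType R) (q : V -> R) (x : V).
Hypothesis subq : sublinear q.

Lemma tilt_le y (t : R) : 0 <= t -> tilt q x y <= q (y + t *: x) - t * q x.
Proof.
move=> t0; apply: ge_inf; last by exists t.
(* The lower bound comes from [s * q x = q (s *: x) <= q (- y) + q (y + s *: x)]. *)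
exists (- q (- y)) => _ [s /= s0 <-]; case: subq => qD qZ.
have := qD (- y) (y + s *: x).
by rewrite addKr qZ//; lra.
Qed.

Lemma tilt_ge y c :
  (forall t : R, 0 <= t -> c <= q (y + t *: x) - t * q x) -> c <= tilt q x y.
Proof.
move=> h; apply: lb_le_inf; first by exists (q (y + 0 *: x) - 0 * q x), 0 => /=.
by move=> _ [t /= t0 <-]; exact: h.
Qed.

Lemma sublinear_tilt : sublinear (tilt q x).
Proof.
case: subq => qD qZ; split=> [u v|].
  rewrite -lerBlDl; apply: tilt_ge => s s0.
  rewrite lerBlDl -lerBlDr; apply: tilt_ge => t t0.
  have := tilt_le (u + v) (addr_ge0 t0 s0).
  rewrite scalerDl addrACA mulrDl.
  by have := qD (u + t *: x) (v + s *: x); lra.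
(* One inequality is enough: applied to [c^-1] and [c *: v] it gives the reverse one. *)
have tiltZ (c : R) v : 0 < c -> tilt q x (c *: v) <= c * tilt q x v.
  move=> c0; rewrite -ler_pdivrMl//; apply: tilt_ge => t t0.
  rewrite ler_pdivrMl//.
  have := tilt_le (c *: v) (mulr_ge0 (ltW c0) t0).
  by rewrite -scalerA -scalerDr qZ ?(ltW c0)// mulrBr mulrA.
move=> c v; rewrite le_eqVlt => /predU1P[<-|c0].
  rewrite scale0r mul0r; apply/eqP; rewrite eq_le; apply/andP; split.
    have := tilt_le 0 (lexx 0); rewrite scale0r addr0 mul0r subr0.
    by have := qZ 0 0 (lexx _); rewrite scale0r mul0r => ->.
  by apply: tilt_ge => t t0; rewrite add0r qZ// subrr.
apply/eqP; rewrite eq_le tiltZ//=.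
have := tiltZ c^-1 (c *: v); rewrite invr_gt0 => /(_ c0).
by rewrite scalerA mulVf ?gt_eqF// scale1r ler_pdivlMl.
Qed.

End Tilt.

(* A pointwise minimal sublinear functional q is linear: minimality forces
   tilt q x = q for every x, hence q y + q x <= q (y + x). *)
Lemma minimal_sublinear_linear (R : realType) (V : lmodType R) (q : V -> R) :
  sublinear q ->
  (forall q', sublinear q' -> (forall v, q' v <= q v) ->
     forall v, q v <= q' v) ->
  linear (q : V -> R^o).
Proof.
move=> subq qmin; have [qD qZ] := subq.
have qA u v : q (u + v) = q u + q v.
  apply/eqP; rewrite eq_le qD/=.
  have tiltq y : tilt q v y <= q y.
    by have := tilt_le v subq y (lexx 0); rewrite scale0r addr0 mul0r subr0.
  have := qmin _ (sublinear_tilt v subq) tiltq u.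
  have := tilt_le v subq u ler01; rewrite scale1r mul1r.
  by lra.
have q0 : q 0 = 0 by have := qZ 0 0 (lexx _); rewrite scale0r mul0r.
have qN u : q (- u) = - q u by have := qA (- u) u; rewrite addNr q0; lra.
move=> a u v; rewrite qA; congr (_ + _).
have [a0|/ltW a0] := leP 0 a; first exact: qZ.
by rewrite -[a]opprK scaleNr qN qZ ?oppr_ge0// scaleNr.
Qed.

(** Zorn's lemma for the reversed pointwise order on sublinear functionals below [p]. A nonempty
    chain is bounded by its pointwise infimum, which is finite because every member is at least
    [- p (- v)] at [v]. *)
Lemma exists_minimal_sublinear (R : realType) (V : lmodType R) (p : V -> R) :
  sublinear p -> exists q : V -> R, [/\ sublinear q, forall v, q v <= p v &
  forall q', sublinear q' -> (forall v, q' v <= q v) -> forall v, q v <= q' v].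
Proof.
move=> subp.
pose T := {q : V -> R | sublinear q /\ forall v, q v <= p v}.
pose r : rel T := fun q1 q2 => `[< forall v, sval q2 v <= sval q1 v >].
have subT (q : T) : sublinear (sval q) by case: (svalP q).
have leT (q : T) v : sval q v <= p v by case: (svalP q).
have Tp : sublinear p /\ forall v, p v <= p v by [].
have [|q1 q2 q3 /asboolP q12 /asboolP q23||q qmax] := @ZL_preorder T (exist _ p Tp) r.
- by move=> q; apply/asboolP.
- by apply/asboolP => v; exact: le_trans (q12 v).
- move=> A Atot; have [->|/set0P[q0 Aq0]] := eqVneq A set0.
    by exists (exist _ p Tp).
  pose B v := [set sval q v | q in A].
  have Bn0 v : B v !=set0 by exists (sval q0 v), q0.
  have Blb v : has_lbound (B v).
    exists (- p (- v)) => _ [q _ <-].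
    by apply: le_trans (sublinear_ge (subT q) _); rewrite lerN2.
  pose m v := inf (B v).
  have mle q v : A q -> m v <= sval q v by move=> Aq; apply: ge_inf => //; exists q.
  have mge v c : (forall q, A q -> c <= sval q v) -> c <= m v.
    by move=> h; apply: lb_le_inf => // _ [q Aq <-]; exact: h.
  have subm : sublinear m.
    split=> [u v|t v].
      rewrite -lerBlDl; apply/mge => q1 Aq1.
      rewrite lerBlDl -lerBlDr; apply/mge => q2 Aq2; rewrite lerBlDr.
      (* The smaller of [q1] and [q2] is used on [u + v], and on both summands it is at most the
         functional chosen there. *)
      have [/asboolP q12|/asboolP q21] := Atot _ _ Aq1 Aq2.
        apply: le_trans (mle _ _ Aq2) _; apply: le_trans ((subT q2).1 _ _) _.
        by rewrite lerD2l.
      apply: le_trans (mle _ _ Aq1) _; apply: le_trans ((subT q1).1 _ _) _.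
      by rewrite lerD2r.
    rewrite le_eqVlt => /predU1P[<-|t0].
      rewrite scale0r mul0r.
      have q00 (q : T) : sval q 0 = 0 :> R.
        by have := (subT q).2 0 0 (lexx _); rewrite scale0r mul0r.
      apply/eqP; rewrite eq_le; apply/andP; split; first by rewrite -(q00 q0) mle.
      by apply/mge => q _; rewrite q00.
    apply/eqP; rewrite eq_le; apply/andP; split.
      rewrite -ler_pdivrMl//; apply/mge => q Aq; rewrite ler_pdivrMl//.
      by rewrite -(subT q).2 ?(ltW t0)// mle.
    apply/mge => q Aq; rewrite (subT q).2 ?(ltW t0)//.
    by rewrite ler_pM2l// mle.
  have mp v : m v <= p v by apply: le_trans (mle q0 v Aq0) _; exact: leT.
  by exists (exist _ m (conj subm mp)) => q Aq; apply/asboolP => v /=; exact: mle.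
exists (sval q); split=> //.
move=> q' sq' q'q.
have Tq' : sublinear q' /\ forall v, q' v <= p v.
  by split=> // v; apply: le_trans (q'q v) (leT q v).
by have /asboolP := qmax (exist _ q' Tq') (asboolT q'q).
Qed.

(** A minimal functional below [tilt p e], rather than below [p] itself, is linear and is at most
    [- p e] at [- e]; this forces the value [p e] at [e]. *)
Lemma hahn_banach_sublinear (R : realType) (V : lmodType R) (p : V -> R) (e : V) :
  sublinear p ->
  exists f : {linear V -> R^o}, (forall v, f v <= p v) /\ f e = p e :> R.
Proof.
move=> subp.
have [q [subq qle qmin]] := exists_minimal_sublinear (sublinear_tilt e subp).
have qlin := minimal_sublinear_linear subq qmin.
pose f : {linear V -> R^o} := HB.pack q (GRing.isLinear.Build _ _ _ _ q qlin).
have fp v : q v <= p v.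
  apply: le_trans (qle v) _.
  by have := tilt_le e subp v (lexx 0); rewrite scale0r addr0 mul0r subr0.
exists f; split=> //; apply/eqP; rewrite eq_le fp/=.
have /= fN : f (- e) = - f e by exact: raddfN.
have := le_trans (qle (- e)) (tilt_le e subp (- e) ler01).
have := subp.2 0 0 (lexx _); rewrite scale1r addNr scale0r !mul0r mul1r => ->.
by move: fN => /= ->; rewrite sub0r lerN2.
Qed.

(** This property and [norming] are all that the later sections use about the scalars beyond
    [numFieldType], so the real and complex cases are treated at once. *)
Definition inf_complete (K : numFieldType) :=
  forall A : set K, A !=set0 -> (forall a, A a -> 0 <= a) -> infimums A !=set0.

Definition norming (K : numFieldType) := forall (X : normedModType K) (e : X),
  exists f : {linear X -> K^o}, (forall z, `|f z| <= `|z|) /\ f e = `|e|.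

Lemma inf_complete_real (R : realType) : inf_complete (R : numFieldType).
Proof.
move=> A A0 Age0; have Alb : has_lbound A by exists 0.
exists (inf A); split=> [a|b Ab]; first exact: ge_inf.
exact: lb_le_inf.
Qed.

(** Nonnegative elements of [R[i]] are real, so the infimum is taken over real parts. A lower bound
    [b] is comparable with the real number [a0], hence is real too. *)
Lemma inf_complete_complex (R : realType) : inf_complete (R[i] : numFieldType).
Proof.
move=> A [a0 Aa0] Age0; pose B : set R := [set complex.Re a | a in A].
have AE a : A a -> a = (complex.Re a)%:C%C.
  by move=> /Age0 a_ge0; rewrite RRe_real// ger0_real.
have Blb : has_lbound B.
  by exists 0 => _ [a Aa <-]; rewrite -ler0c -AE//; exact: Age0.
exists (inf B)%:C%C; split=> [a Aa|b Ab].
  by rewrite (AE a Aa) lecR; apply: ge_inf => //; exists a.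
have ba0 := Ab _ Aa0.
have bE : b = (complex.Re b)%:C%C.
  move: ba0; rewrite lecE => /andP[/eqP bIm _].
  by apply/eqP; rewrite eq_complex/= eqxx/= -bIm (AE _ Aa0).
rewrite bE lecR; apply: lb_le_inf; first by exists (complex.Re a0), a0.
by move=> _ [a Aa <-]; rewrite -lecR -bE -AE//; exact: Ab.
Qed.

Lemma norming_real (R : realType) : norming (R : numFieldType).
Proof.
move=> X e; have subn : sublinear (fun x : X => `|x| : R).
  split=> [u v|t v t0]; first exact: ler_normD.
  by rewrite normrZ ger0_norm.
have [f [fle fe]] := hahn_banach_sublinear e subn.
exists f; split=> // z; rewrite ler_norml fle andbT.
by have := fle (- z); rewrite raddfN normrN lerNl.
Qed.

(** An alias that carries the restriction of scalars to [R], kept apart from the complex structure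
    of [X]. *)
Definition realify (R : realType) (X : lmodType R[i]) : Type := X.

Section Realify.
Context (R : realType) (X : lmodType R[i]).

HB.instance Definition _ := GRing.Zmodule.on (realify X).

Definition realify_scale (a : R) (x : realify X) : realify X := a%:C%C *: (x : X).

Lemma realify_scaleA a b v :
  realify_scale a (realify_scale b v) = realify_scale (a * b) v.
Proof. by rewrite /realify_scale scalerA rmorphM. Qed.

Lemma realify_scale1 : left_id 1 realify_scale.
Proof. by move=> v; rewrite /realify_scale rmorph1 scale1r. Qed.

Lemma realify_scaleDr : right_distributive realify_scale +%R.
Proof. by move=> a u v; rewrite /realify_scale scalerDr. Qed.

Lemma realify_scaleDl v : {morph realify_scale^~ v : a b / a + b}.
Proof. by move=> a b; rewrite /realify_scale rmorphD scalerDl. Qed.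

HB.instance Definition _ := GRing.Zmodule_isLmodule.Build R (realify X)
  realify_scaleA realify_scale1 realify_scaleDr realify_scaleDl.

End Realify.

(* Bohnenblust and Sobczyk: x |-> f x - i f (i x) is the complex functional
   with real part f. *)
Lemma norming_complex (R : realType) : norming (R[i] : numFieldType).
Proof.
move=> X e; pose p (x : realify X) : R := complex.Re (`|x : X|).
have pE x : (p x)%:C%C = `|x : X| by rewrite /p RRe_real// ger0_real.
have subp : sublinear p.
  split=> [u v|t v t0].
    by rewrite -lecR rmorphD /= !pE; exact: ler_normD.
  apply: complexI; rewrite rmorphM/= !pE /GRing.scale/= normrZ.
  by rewrite ger0_norm// ler0c.
have [f [fle fe]] := hahn_banach_sublinear (e : realify X) subp.
have fZ (a : R) (x : X) : f (a%:C%C *: x) = a * f x :> R.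
  exact: (linearZ_LR f a (x : realify X)).
have fD (x y : X) : f (x + y) = f x + f y :> R by exact: (raddfD f).
pose g (x : X) : R[i]^o := (f x +i* - f ('i%C *: x))%C.
have glin : linear g.
  move=> [a b] u v; rewrite /g.
  have -> : (a +i* b)%C *: u = a%:C%C *: u + b%:C%C *: ('i%C *: u).
    rewrite scalerA -scalerDl; congr (_ *: _).
    by apply/eqP; rewrite eq_complex/=; apply/andP; split; apply/eqP; ring.
  have iE : 'i%C *: (a%:C%C *: u + b%:C%C *: ('i%C *: u)) =
      a%:C%C *: ('i%C *: u) + (- b)%:C%C *: u.
    rewrite scalerDr !scalerA; congr (_ *: _ + _ *: _);
      by apply/eqP; rewrite eq_complex/=; apply/andP; split; apply/eqP; ring.
  rewrite scalerDr iE !fD !fZ.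
  apply/eqP; rewrite eq_complex/=.
  by apply/andP; split; apply/eqP; ring.
pose G : {linear X -> R[i]^o} := HB.pack g (GRing.isLinear.Build _ _ _ _ g glin).
have Gle z : `|G z| <= `|z|.
  have [->|Gz0] := eqVneq (G z) 0; first by rewrite normr0.
  (* Rotating [z] by the unimodular [w] makes the value of [G] real and nonnegative, hence equal to
     that of its real part [f], which [p] dominates. *)
  pose w : R[i] := `|G z| / G z.
  have w1 : `|w| = 1.
    by rewrite normrM normfV normr_id divff// normr_eq0.
  have Gwz : G (w *: z) = `|G z| by rewrite linearZ/= /GRing.scale/= divfK.
  have <- : `|w *: z| = `|z| by rewrite normrZ w1 mul1r.
  rewrite -pE -Gwz.
  have -> : G (w *: z) = (f (w *: z))%:C%C.
    rewrite -[LHS]RRe_real//.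
    by rewrite Gwz ger0_real.
  by rewrite lecR; exact: fle.
exists G; split=> //.
(* The real part of [G e] is already the norm of [e], which bounds the modulus of [G e]; so the
   imaginary part vanishes. *)
have ReG : complex.Re (G e) = complex.Re `|e| by rewrite /= fe.
apply/eqP; rewrite eq_complex ReG eqxx/=.
have := Gle e; rewrite normc_def -[`|e|]RRe_real ?ger0_real// lecR -ReG.
set a := complex.Re (G e); set b := complex.Im (G e) => le_a.
have a0 : 0 <= a by rewrite (le_trans _ le_a)// sqrtr_ge0.
move: le_a; rewrite -(ler_pXn2r (n := 2))// ?nnegrE ?sqrtr_ge0//.
rewrite sqr_sqrtr ?addr_ge0 ?sqr_ge0// gerDl => b0.
have : b == 0 by rewrite -sqrf_eq0 eq_le b0 sqr_ge0.
by [].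
Qed.

(** * Multilinear maps and polarization *)

Section Multilinear.
Context (K : numFieldType) (d : nat) (X Y : lmodType K) (T : ('I_d -> X) -> Y).
Hypothesis Tlin : multilinear T.

Lemma multilinear_at (i : 'I_d) (a : K) (x y z : 'I_d -> X) :
  x i = a *: y i + z i -> (forall j, j != i -> y j = x j) ->
  (forall j, j != i -> z j = x j) -> T x = a *: T y + T z.
Proof.
move=> xi yx zx.
have dfE w : (forall j, j != i -> w j = x j) -> w = dfwith x i (w i).
  move=> wx; apply/funext => j; have [->|ji] := eqVneq j i.
    by rewrite dfwithin.
  by rewrite dfwithout ?wx// eq_sym.
by rewrite (dfE y yx) (dfE z zx) -Tlin -xi -dfE.
Qed.

Lemma multilinear0 (i : 'I_d) (x : 'I_d -> X) : x i = 0 -> T x = 0.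
Proof.
move=> xi0; rewrite (@multilinear_at i (-1) x x x)//; first by rewrite scaleN1r addNr.
by rewrite xi0 scaler0 addr0.
Qed.

Lemma multilinear_scale (c : 'I_d -> K) (x : 'I_d -> X) :
  T (fun i => c i *: x i) = (\prod_i c i) *: T x.
Proof.
suff h (s : seq 'I_d) : uniq s ->
    T (fun i => if i \in s then c i *: x i else x i) = (\prod_(i <- s) c i) *: T x.
  rewrite -big_enum -h ?enum_uniq//; congr T.
  by apply/funext => i; rewrite mem_enum.
elim: s => [_|a s IH /= /andP[as_ us]]; first by rewrite big_nil scale1r.
rewrite big_cons -scalerA -IH//.
rewrite (@multilinear_at a (c a) _ (fun i => if i \in s then c i *: x i else x i)
   (fun i => if i == a then 0 else if i \in s then c i *: x i else x i)).
- by rewrite (@multilinear0 a (fun i => if i == a then _ else _)) ?addr0 ?eqxx.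
- by rewrite mem_head eqxx addr0 (negbTE as_).
- by move=> j ja; rewrite in_cons (negbTE ja).
- by move=> j ja; rewrite in_cons (negbTE ja).
Qed.

Lemma multilinear_sum_at (i : 'I_d) (J : Type) (s : seq J) (v : J -> X)
    (x : 'I_d -> X) :
  T (dfwith x i (\sum_(j <- s) v j)) = \sum_(j <- s) T (dfwith x i (v j)).
Proof.
elim: s => [|j s IH].
  by rewrite !big_nil (@multilinear0 i)// dfwithin.
by rewrite !big_cons -IH -[v j]scale1r Tlin !scale1r.
Qed.

Lemma multilinear_expand (J : finType) (j0 : J) (v : 'I_d -> J -> X) :
  T (fun i => \sum_j v i j) = \sum_(f : {ffun 'I_d -> J}) T (fun i => v i (f i)).
Proof.
(* Induction on the list [s] of coordinates already expanded. Choice functions are frozen at [j0]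
   outside [s], so that each choice on [s] is counted once. *)
pose F (s : seq 'I_d) (i : 'I_d) : pred J := if i \in s then predT else pred1 j0.
pose w (s : seq 'I_d) (f : {ffun 'I_d -> J}) i :=
  if i \in s then v i (f i) else \sum_j v i j.
suff h (s : seq 'I_d) : uniq s ->
    T (fun i => \sum_j v i j) = \sum_(f in family (F s)) T (w s f).
  rewrite (h (enum 'I_d)) ?enum_uniq//; apply: eq_big => [f|f _].
    by apply/familyP => i; rewrite /F mem_enum.
  by congr T; apply/funext => i; rewrite /w mem_enum.
elim: s => [_|a s IH /= /andP[as_ us]].
  rewrite (big_pred1 [ffun=> j0]) => [|f].
    by congr T; apply/funext => i; rewrite /w in_nil.
  apply/familyP/eqP => [fF|-> i]; last by rewrite /F ffunE inE.
  by apply/ffunP => i; rewrite ffunE; apply/eqP; have := fF i; rewrite /F in_nil.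
have upd (f : {ffun 'I_d -> J}) j i : [ffun k => if k == a then j else f k] i =
    if i == a then j else f i by rewrite ffunE.
rewrite (IH us).
have E f : T (w s f) = \sum_j T (dfwith (w s f) a (v a j)).
  rewrite -multilinear_sum_at; congr T; apply/funext => i.
  have [->|ia] := eqVneq i a; first by rewrite dfwithin /w (negbTE as_).
  by rewrite dfwithout// eq_sym.
rewrite (eq_bigr _ (fun f _ => E f)).
rewrite pair_big/=.
(* A choice function [g] on [a :: s] corresponds to its restriction to [s], reset to [j0] at [a],
   paired with its value at [a]. *)
rewrite (reindex_onto
  (fun g : {ffun 'I_d -> J} =>
     ([ffun k => if k == a then j0 else g k] : {ffun 'I_d -> J}, g a))
  (fun p : {ffun 'I_d -> J} * J => [ffun k => if k == a then p.2 else p.1 k])) /=.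
  apply: eq_big => [g|g _].
    rewrite andbT; apply/andP/familyP => [[/familyP gF _] i|gF].
      have := gF i; rewrite /F in_cons ffunE.
      by have [->|ia]//= := eqVneq i a.
    split.
      apply/familyP => i; have := gF i; rewrite /F in_cons ffunE.
      by have [->|ia]//= := eqVneq i a; rewrite (negbTE as_) => _; exact: eqxx.
    by apply/eqP/ffunP => i; rewrite !ffunE; case: eqP => // ->.
  congr T; apply/funext => i; rewrite /w in_cons.
  have [->|ia] := eqVneq i a; first by rewrite dfwithin.
  by rewrite dfwithout 1?eq_sym//= ffunE (negbTE ia).
move=> [f j] /= /andP[/familyP fF _]; rewrite ffunE eqxx; congr pair.
apply/ffunP => i; rewrite !ffunE; have [->|//] := eqVneq i a.
by have := fF a; rewrite /F (negbTE as_) inE => /eqP.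
Qed.

End Multilinear.

Section SymmetricTensors.
Context (K : numFieldType) (d : nat) (X : lmodType K).
Hypothesis d_gt0 : (0 < d)%N.

Lemma stensor_val_linear : linear (@stensor_val K d X).
Proof.
by move=> a u v; rewrite /stensor_val -[LHS]/(\val (a *: u + v)) linearP.
Qed.

HB.instance Definition _ :=
  GRing.isLinear.Build K _ _ _ (@stensor_val K d X) stensor_val_linear.

Definition stensor_eval (A : mform d X) (u : stensor d X) : K^o :=
  span_val (stensor_val u) A.

Lemma stensor_eval_linear A : linear (stensor_eval A).
Proof.
move=> a u v; rewrite /stensor_eval linearP.
by rewrite -[span_val (_ *: _ + _)]/(\val (_ *: _ + _)) linearP.
Qed.

HB.instance Definition _ A :=
  GRing.isLinear.Build K (stensor d X) K^o _ (stensor_eval A) (stensor_eval_linear A).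

Lemma stensor_eval_inj (u v : stensor d X) :
  (forall A, stensor_eval A u = stensor_eval A v) -> u = v.
Proof. by move=> uv; do 2! apply/val_inj; apply/funext => A; exact: uv. Qed.

Lemma stensor_eval_tpow A x : stensor_eval A (tpow d x) = A (fun=> x).
Proof. by []. Qed.

Lemma stensorP (u : stensor d X) : exists n (c : 'I_n -> K) (x : 'I_n -> X),
  u = \sum_(i < n) c i *: tpow d (x i).
Proof.
have /asboolP[n [c [s [Ss uE]]]] := span_valP u.
have /choice[x xE] : forall i, exists x, tens (fun=> x) = s i.
  by move=> i; have [x _ <-] := Ss i; exists x.
exists n, c, x; apply: val_inj.
rewrite -[RHS]/(stensor_val _) linear_sum -[LHS]/(span_val u) uE.
by apply: eq_bigr => i _; rewrite -xE [RHS](linearZ_LR (@stensor_val K d X)).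
Qed.

(* Polarization: evaluated at a d-linear form A, the alternating sum over
   subsets J leaves only the terms A (x \o f) with f onto. *)
Definition sym (x : 'I_d -> X) : stensor d X :=
  (d`!)%:R^-1 *: \sum_(J : {set 'I_d})
     (-1) ^+ #|~: J| *: tpow d (\sum_(j in J) x j).

(** Distribute the product over [j] of [1 - (j \notin codom f)%:R], where [J] collects the factors
    contributing [1]: the term of [J] is the sign times the indicator of [codom f] being inside [J].
    The product is 1 if [f] is onto, that is injective, and 0 otherwise. *)
Lemma sum_sign_subset_image (f : {ffun 'I_d -> 'I_d}) :
  \sum_(J : {set 'I_d}) (-1) ^+ #|~: J| * (\prod_i (f i \in J)%:R) =
  (injectiveb f)%:R :> K.
Proof.
transitivity (\prod_j (1 - (j \notin codom f)%:R) : K).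
  rewrite bigA_distr; apply: eq_bigr => J _.
  have [fJ|] := boolP [forall i, f i \in J].
    rewrite [X in _ * X]big1 ?mulr1 => [|i _]; last by rewrite (forallP fJ).
    rewrite (bigID (mem J))/= [X in _ = X * _]big1 ?mul1r => [|j ->//].
    rewrite (eq_bigr (fun=> -1)) => [|j jJ].
      by rewrite prodr_const; congr (_ ^+ _); apply: eq_card => j; rewrite !inE.
    rewrite (negbTE jJ) (_ : j \notin codom f)//.
    by apply: contra jJ => /codomP[i ->]; exact: (forallP fJ).
  rewrite negb_forall => /existsP[i fiJ].
  rewrite (bigD1 i)//= (negbTE fiJ) mul0r mulr0.
  by rewrite (bigD1 (f i))//= (negbTE fiJ) codom_f oppr0 mul0r.
have [/injectiveP finj|finj] := boolP (injectiveb f).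
  rewrite big1// => j _; have /codomP[i ->] : j \in codom f.
    by rewrite (inj_card_onto finj).
  by rewrite codom_f subr0.
have [j jf] : exists j, j \notin codom f.
  apply/existsP; apply: contraR finj => /existsPn fonto.
  have /image_injP finj : #|codom f| == #|{: 'I_d}|.
    by apply/eqP/eq_card => j; have := fonto j; rewrite negbK => ->.
  by apply/injectiveP => i j; exact: finj.
by rewrite (bigD1 j)//= jf subrr mul0r.
Qed.

(** After expanding [A] at each subset sum and exchanging the sums, only permutations survive. The
    resulting average makes the multilinearity of [sym] and its values on the diagonal visible. *)
Lemma stensor_eval_sym A (x : 'I_d -> X) :
  stensor_eval A (sym x) = (d`!)%:R^-1 * \sum_(s : 'S_d) A (fun i => x (s i)).
Proof.
rewrite /sym linearZ/=; congr (_ * _).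
have E (J : {set 'I_d}) : A (fun=> \sum_(j in J) x j) =
    \sum_(f : {ffun 'I_d -> 'I_d}) (\prod_i (f i \in J)%:R) * A (fun i => x (f i)).
  have -> : (fun _ : 'I_d => \sum_(j in J) x j) =
              (fun _ => \sum_j (j \in J)%:R *: x j).
      apply/funext => _; rewrite big_mkcond/=; apply: eq_bigr => j _.
      by case: (j \in J); rewrite ?scale1r ?scale0r.
  rewrite (multilinear_expand (mformP A) (Ordinal d_gt0)
    (fun _ j => (j \in J)%:R *: x j)).
    apply: eq_bigr => f _.
    by rewrite (multilinear_scale (mformP A) (fun i => (f i \in J)%:R)).
rewrite raddf_sum/=.
under eq_bigr => J _ do rewrite linearZ/= stensor_eval_tpow E /GRing.scale/= mulr_sumr.
rewrite exchange_big/=.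
under eq_bigr => f _.
  under eq_bigr => J _ do rewrite mulrA.
  rewrite -mulr_suml sum_sign_subset_image.
  over.
rewrite (bigID (fun f : {ffun 'I_d -> 'I_d} => injectiveb f)) /=.
rewrite addrC big1 ?add0r => [|f fi]; last first.
  by rewrite (negbTE fi) mul0r.
rewrite (reindex (@pval _)) /=; last first.
  pose in_Sn := insubd (1%g : 'S_d).
  by exists in_Sn => /= f fi; first apply: val_inj; apply: insubdK.
apply: eq_big => [s|s fi]; first by rewrite (valP s).
rewrite fi mul1r; congr (A _); apply/funext => i.
by rewrite pvalE.
Qed.

Lemma sym_multilinear : multilinear sym.
Proof.
move=> x i a u v; apply: stensor_eval_inj => A.
rewrite linearP/= !stensor_eval_sym -[RHS]/(a * (_ * _) + _ * _) mulrCA -mulrDr.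
congr (_ * _); rewrite mulr_sumr -big_split/=; apply: eq_bigr => s _.
(* In the term of [s], the coordinate [x i] stands in slot [s^-1 i]. *)
apply: (multilinear_at (mformP A) (i := (s^-1)%g i)); rewrite /= ?permKV.
- by rewrite !dfwithin.
- by move=> j ji; rewrite !dfwithout//; apply: contra ji => /eqP ->; rewrite permK.
- by move=> j ji; rewrite !dfwithout//; apply: contra ji => /eqP ->; rewrite permK.
Qed.

Lemma sym_diag x : sym (fun=> x) = tpow d x.
Proof.
apply: stensor_eval_inj => A; rewrite stensor_eval_sym sumr_const.
set n := #|_|; have -> : n = d`! by rewrite /n -card_Sn.
have -> : A (fun=> x) *+ d`! = (d`!)%:R * (A (fun=> x) : K) :> K by rewrite mulr_natl.
by rewrite mulKf// pnatr_eq0 -lt0n fact_gt0.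
Qed.

End SymmetricTensors.

(** * Projective norm and linearization of polynomials *)

Lemma cvg_ptws (I : Type) (V : topologicalType) (F : set_system {ptws I -> V})
    (f : {ptws I -> V}) :
  Filter F -> (forall i, (fun g : {ptws I -> V} => g i) @ F --> f i) -> F --> f.
Proof.
move=> FF Ff; apply/cvg_sup => i.
apply/cvg_image; first by rewrite eqEsubset; split=> v // _; exists (fun=> v).
move=> W /Ff FW; exists ((fun g : {ptws I -> V} => g i) @^-1` W) => //.
by rewrite eqEsubset; split=> [v [g Wg <-]//|v Wv]; exists (fun=> v).
Qed.

Lemma diag_continuous (I : Type) (V : topologicalType) :
  continuous (fun x : V => (fun=> x) : {ptws I -> V}).
Proof. by move=> x; apply: cvg_ptws => i; exact: cvg_id. Qed.

Section InfimumSupremum.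
Context (K : numFieldType).
Hypothesis infK : inf_complete K.
Implicit Types (A : set K) (a b : K).

Lemma infimum_lb A a : (forall a, A a -> 0 <= a) -> A a -> infimum 0 A <= a.
Proof.
move=> A0 Aa; have An0 : A !=set0 by exists a.
rewrite /infimum ifF; last by apply/negbTE/set0P.
by have /(xgetPex 0)[lb _] := infK An0 A0; exact: lb.
Qed.

Lemma infimum_glb A b : A !=set0 -> (forall a, A a -> 0 <= a) ->
  (forall a, A a -> b <= a) -> b <= infimum 0 A.
Proof.
move=> An0 A0 Ab; rewrite /infimum ifF; last by apply/negbTE/set0P.
by have /(xgetPex 0)[_ ub] := infK An0 A0; exact: ub.
Qed.

Lemma infimum_min A a : A a -> (forall b, A b -> a <= b) -> infimum 0 A = a.
Proof.
move=> Aa Aleb; have An0 : A !=set0 by exists a.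
rewrite /infimum ifF; last by apply/negbTE/set0P.
have infa : infimums A a by split=> // b Ab; exact: Ab.
have [lb ub] := xgetPex 0 (ex_intro _ a infa).
by apply/eqP; rewrite eq_le lb//= ub.
Qed.

(** The supremum is the infimum of the upper bounds, which are nonnegative because [A] has a
    nonnegative element. *)
Lemma supremums_neq0 A b : A !=set0 -> (forall a, A a -> 0 <= a) ->
  ubound A b -> supremums A !=set0.
Proof.
move=> [a0 Aa0] A0 Ab.
have [||m [lb ub]] := infK (A := ubound A); first by exists b.
  by move=> c /(_ _ Aa0); apply: le_trans; exact: A0.
by exists m; split=> [a Aa|c Ac]; [apply: ub => c Ac; exact: Ac|exact: lb].
Qed.

Lemma supremum_ub A b a : (forall a, A a -> 0 <= a) -> ubound A b ->
  A a -> a <= supremum 0 A.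
Proof.
move=> A0 Ab Aa; have An0 : A !=set0 by exists a.
rewrite /supremum ifF; last by apply/negbTE/set0P.
by have /(xgetPex 0)[ub _] := supremums_neq0 An0 A0 Ab; exact: ub.
Qed.

Lemma supremum_lub A b : A !=set0 -> (forall a, A a -> 0 <= a) -> ubound A b ->
  supremum 0 A <= b.
Proof.
move=> An0 A0 Ab; rewrite /supremum ifF; last by apply/negbTE/set0P.
by have /(xgetPex 0)[_ lb] := supremums_neq0 An0 A0 Ab; exact: lb.
Qed.

End InfimumSupremum.

Section SPi.
Context (K : numFieldType) (d : nat) (X : normedModType K).
Hypothesis infK : inf_complete K.

Lemma s_pi_le n (c : 'I_n -> K) (x : 'I_n -> X) :
  s_pi (\sum_i c i *: tpow d (x i)) <= \sum_i `|c i| * `|x i| ^+ d.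
Proof.
apply: infimum_lb => //; last by exists n, c, x.
move=> _ [m [e [y [_ ->]]]]; apply: sumr_ge0 => i _.
by rewrite mulr_ge0// exprn_ge0.
Qed.

Lemma s_pi_tpow (x : X) : s_pi (tpow d x) <= `|x| ^+ d.
Proof.
have := s_pi_le (fun _ : 'I_1 => 1) (fun _ => x).
by rewrite !big_ord1 scale1r normr1 mul1r.
Qed.

Lemma s_pi_ge (u : stensor d X) (r : K) :
  (forall n (c : 'I_n -> K) (x : 'I_n -> X), u = \sum_i c i *: tpow d (x i) ->
     r <= \sum_i `|c i| * `|x i| ^+ d) ->
  r <= s_pi u.
Proof.
move=> h; apply: infimum_glb => //.
- have [n [c [x uE]]] := stensorP u.
  by exists (\sum_i `|c i| * `|x i| ^+ d), n, c, x.
- move=> _ [m [e [y [_ ->]]]]; apply: sumr_ge0 => i _.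
  by rewrite mulr_ge0// exprn_ge0.
- by move=> _ [m [e [y [uE ->]]]]; exact: h.
Qed.

End SPi.

Section Polynomials.
Context (K : numFieldType) (d : nat) (X Y : normedModType K).
Hypothesis d_gt0 : (0 < d)%N.
Hypothesis infK : inf_complete K.
Hypothesis normingK : norming K.

Lemma hpolyZ (P : X -> Y) (a : K) (x : X) :
  hpoly d P -> P (a *: x) = a ^+ d *: P x.
Proof.
move=> [T [Tlin _ PE]]; rewrite !PE (multilinear_scale Tlin (fun=> a)).
by rewrite prodr_const card_ord.
Qed.

Lemma hpoly0 (P : X -> Y) : hpoly d P -> P 0 = 0.
Proof. by move=> hP; rewrite -(scale0r 0) hpolyZ// expr0n gtn_eqF// scale0r. Qed.

Lemma hpoly_bounded (P : X -> Y) : hpoly d P ->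
  exists2 M, 0 <= M & forall x, `|P x| <= M * `|x| ^+ d.
Proof.
move=> hP; have [T [Tlin Tcont PE]] := hP.
have Pcont : {for 0, continuous P}.
  have -> : P = (T : {ptws 'I_d -> X} -> Y) \o (fun x => (fun=> x)).
    by apply/funext => x; rewrite PE.
  by apply: continuous_comp; [exact: diag_continuous|exact: Tcont].
have /cvgrPdist_le/(_ 1 ltr01) := Pcont.
rewrite (hpoly0 hP) => /nbhs_norm0P[r /= r0 Pr].
exists ((r / 2) ^+ d)^-1 => [|x]; first by rewrite invr_ge0 exprn_ge0// divr_ge0// ltW.
have [->|x0] := eqVneq x 0.
  by rewrite (hpoly0 hP) !normr0 expr0n gtn_eqF// mulr0.
have nx0 : 0 < `|x| by rewrite normr_gt0.
(* Continuity at 0 bounds [P] by 1 on the ball of radius [r]; [t] brings [x] to norm [r / 2],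
   strictly inside, and homogeneity scales the bound back. *)
pose t := r / 2 / `|x|.
have t0 : 0 < t by rewrite divr_gt0// divr_gt0.
have := Pr (t *: x); rewrite /= normrZ gtr0_norm// divfK ?gt_eqF//.
rewrite ltr_pdivrMr// ltr_pMr// ltr1n => /(_ isT).
rewrite sub0r normrN hpolyZ// normrZ gtr0_norm ?exprn_gt0// /t exprMn exprVn.
by rewrite mulrAC ler_pdivrMr ?exprn_gt0// mul1r ler_pdivlMl// exprn_gt0// divr_gt0.
Qed.

Lemma sup_norm_ge0 (P : X -> Y) M : (forall x, `|x| <= 1 -> `|P x| <= M) ->
  0 <= sup_norm P.
Proof.
move=> PM; apply: le_trans (normr_ge0 (P 0)) _.
apply: (@supremum_ub _ infK _ M); last by exists 0 => //=; rewrite normr0.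
  by move=> _ [x _ <-].
by move=> _ [x /= x1 <-]; exact: PM.
Qed.

Lemma sup_norm_le (P : X -> Y) M : (forall x, `|x| <= 1 -> `|P x| <= M) ->
  sup_norm P <= M.
Proof.
move=> PM; apply: supremum_lub => //.
- by exists `|P 0|, 0 => //=; rewrite normr0.
- by move=> _ [x _ <-].
- by move=> _ [x /= x1 <-]; exact: PM.
Qed.

Lemma hpoly_bounded_ball (P : X -> Y) : hpoly d P ->
  exists M, forall x, `|x| <= 1 -> `|P x| <= M.
Proof.
move=> /hpoly_bounded[M M0 PM]; exists M => x x1.
by apply: le_trans (PM x) _; rewrite ler_piMr// exprn_ile1.
Qed.

Lemma hpoly_le (P : X -> Y) (x : X) : hpoly d P ->
  `|P x| <= sup_norm P * `|x| ^+ d.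
Proof.
move=> hP; have [M PM] := hpoly_bounded_ball hP.
have [->|x0] := eqVneq x 0.
  by rewrite (hpoly0 hP) !normr0 expr0n gtn_eqF// mulr0.
have nx0 : 0 < `|x| by rewrite normr_gt0.
rewrite -ler_pdivrMr ?exprn_gt0//.
have -> : `|P x| / `|x| ^+ d = `|P (`|x|^-1 *: x)|.
  by rewrite hpolyZ// normrZ normrX normfV normr_id exprVn mulrC.
apply: (@supremum_ub _ infK _ M); first by move=> _ [z _ <-].
  by move=> _ [z /= z1 <-]; exact: PM.
exists (`|x|^-1 *: x) => //=.
by rewrite normrZ normfV normr_id mulVf// normr_eq0.
Qed.

Lemma stensor_linearization (P : X -> Y) : hpoly d P ->
  exists L : {linear stensor d X -> Y}, forall x, L (tpow d x) = P x.
Proof.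
move=> [T [Tlin _ PE]].
have /choice[rep repE] : forall u : stensor d X,
    exists r : {n & ('I_n -> K) * ('I_n -> X)}%type,
    u = \sum_i (projT2 r).1 i *: tpow d ((projT2 r).2 i).
  by move=> u; have [n [c [x uE]]] := stensorP u; exists (existT _ n (c, x)).
(* [rep] is an arbitrary choice of representation. By [LE] the choice disappears after any
   functional, and functionals separate the points of [Y]. *)
pose L u : Y := \sum_i (projT2 (rep u)).1 i *: P ((projT2 (rep u)).2 i).
have LE (f : {linear Y -> K^o}) : exists2 A : mform d X,
    forall u, f (L u) = stensor_eval A u & forall x, A (fun=> x) = f (P x).
  have fT : multilinear (f \o T) by move=> x i a u v; rewrite /= Tlin linearP.
  exists (MForm fT) => [u|x]; last by rewrite PE.
  rewrite [in RHS](repE u) !linear_sum.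
  by apply: eq_bigr => i _; rewrite !linearZ/= PE.
have Leq y z : (forall f : {linear Y -> K^o}, f y = f z) -> y = z.
  move=> fyz; have [f [_ fE]] := normingK (y - z).
  apply/subr0_eq/normr0_eq0; rewrite -fE linearB/= fyz subrr//.
have Llin : linear L.
  move=> a u v; apply: Leq => f; have [A fL _] := LE f.
  by rewrite linearP !fL linearP.
exists (HB.pack L (GRing.isLinear.Build _ _ _ _ L Llin) : {linear _ -> _}) => x /=.
by apply: Leq => f; have [A -> <-] := LE f.
Qed.

Lemma linearization_le (P : X -> Y) (L : {linear stensor d X -> Y}) :
  hpoly d P -> (forall x, L (tpow d x) = P x) ->
  forall u, `|L u| <= sup_norm P * s_pi u.
Proof.
move=> hP LP u; have [M PM] := hpoly_bounded_ball hP.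
(* Passing to the infimum in [s_pi] requires dividing by [sup_norm P]; when that is 0, [P] and hence
   [L] vanish. *)
have := sup_norm_ge0 PM; rewrite le_eqVlt => /predU1P[P0|Pgt0].
  have [n [c [x ->]]] := stensorP u.
  rewrite linear_sum big1 ?normr0 -?P0 ?mul0r// => i _.
  rewrite linearZ/= LP; have := hpoly_le (x i) hP.
  by rewrite -P0 mul0r normr_le0 => /eqP ->; rewrite scaler0.
rewrite -ler_pdivrMl//; apply: s_pi_ge => // n c x ->.
rewrite ler_pdivrMl// linear_sum mulr_sumr.
apply: le_trans (ler_norm_sum _ _ _) _; apply: ler_sum => i _.
by rewrite linearZ/= normrZ LP mulrCA ler_wpM2l// hpoly_le.
Qed.

End Polynomials.

(** * Extension by density, and continuity of bounded multilinear maps *)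

Lemma linear_le_continuous (K : numFieldType) (V W : normedModType K)
    (f : {linear V -> W}) (M : K) :
  0 <= M -> (forall x, `|f x| <= M * `|x|) -> continuous f.
Proof.
move=> M0 fM; apply: bounded_linear_continuous; apply/linear_boundedP.
exists M; split=> [|r Mr x]; first exact: ger0_real.
by apply: le_trans (fM x) _; rewrite ler_wpM2r// ltW.
Qed.

(** The value at [z] is characterized by the relation [G z y]. Completeness of [Y] gives existence,
    density gives uniqueness, and since [G] is compatible with linear combinations, uniqueness makes
    the extension linear. *)
Lemma exists_bounded_extension (K : numFieldType) (U : lmodType K)
    (C : normedModType K) (Y : completeNormedModType K) (j : {linear U -> C})
    (L : {linear U -> Y}) (M : K) :
  dense (range j) -> 0 <= M -> (forall u, `|L u| <= M * `|j u|) ->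
  exists T : C -> Y, [/\ linear T, continuous T & forall u, T (j u) = L u].
Proof.
move=> jdense M0 LM.
have near_range (z : C) (N : set C) : nbhs z N -> exists u, N (j u).
  move=> zN; have [e /= e0 eN] := (nbhs_ballP _ _).1 zN.
  have [|c [zc [u _ uE]]] := jdense (ball z e) _ (ball_open z e).
    by exists z; exact: ballxx.
  by exists u; apply: eN; rewrite uE.
have near_j (z : C) (e : K) : 0 < e -> exists u, `|z - j u| < e.
  move=> e0; have := near_range z (ball z e) (nbhsx_ballx _ _ e0).
  by rewrite -ball_normE.
have LB u v : `|L u - L v| <= M * `|j u - j v| by rewrite -!linearB.
pose G (z : C) (y : Y) := forall u, `|y - L u| <= M * `|z - j u|.
have Gj u : G (j u) (L u) by move=> v; exact: LB.
have M1 : 0 < M + 1 by rewrite ltr_wpDl.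
have Gex z : exists y, G z y.
  (* The image under [L] of the neighbourhoods of [z] traced on the range of [j]; its limit is the
     required value. *)
  pose F : set_system Y :=
    [set A | exists2 N, nbhs z N & forall u, N (j u) -> A (L u)].
  have FP : ProperFilter F.
    split; first by move=> [N /near_range[u Nu] /(_ u Nu)].
    split; first by exists setT => //; exact: filterT.
      move=> A B [N zN NA] [N' zN' N'B]; exists (N `&` N'); first exact: filterI.
      by move=> u [Nu N'u]; split; [exact: NA|exact: N'B].
    by move=> A B AB [N zN NA]; exists N => // u Nu; apply: AB; exact: NA.
  have /cauchy_cvg Fcvg : cauchy F.
    (* Dividing by [M + 1] instead of [M] covers [M = 0] and makes [M * (r + r) < e] strict. *)
    apply: cauchy_exP => e e0; pose r := e / (M + 1) / 2.
    have r0 : 0 < r by rewrite !divr_gt0.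
    have [u zu] := near_j z r r0.
    exists (L u); exists (ball z r); first exact: nbhsx_ballx _ _ r0.
    move=> v; rewrite -!ball_normE /= => zv; apply: le_lt_trans (LB u v) _.
    apply: le_lt_trans (_ : M * (r + r) < e).
      rewrite ler_wpM2l//; apply: le_trans (ler_distD z _ _) _.
      by rewrite lerD// ltW// distrC.
    by rewrite /r -splitr mulrCA gtr_pMr// ltr_pdivrMr// mul1r ltrDl.
  exists (lim F) => u; apply/ler_addgt0Pr => e e0.
  pose r := e / (M + 1); have r0 : 0 < r by rewrite divr_gt0.
  have [N zN NF] := Fcvg (ball (lim F) r) (nbhsx_ballx _ _ r0).
  have [v [Nv zv]] := near_range z (N `&` ball z r) (filterI zN (nbhsx_ballx _ _ r0)).
  have := NF v Nv; rewrite -ball_normE/= => Lv.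
  move: zv; rewrite -ball_normE/= => zv.
  apply: le_trans (ler_distD (L v) _ _) _.
  apply: le_trans (_ : r + M * (r + `|z - j u|) <= _).
    apply: lerD; first exact: ltW.
    apply: le_trans (LB v u) _; rewrite ler_wpM2l//.
    by apply: le_trans (ler_distD z _ _) _; rewrite lerD2r ltW// distrC.
  rewrite mulrDr addrA addrC lerD2l -[X in X + _]mul1r -mulrDl addrC.
  by rewrite /r mulrC divfK// gt_eqF.
have Guniq z y y' : G z y -> G z y' -> y = y'.
  move=> Gy Gy'; apply/eqP; rewrite -subr_eq0 -normr_le0.
  apply/ler_addgt0Pr => e e0; rewrite add0r.
  pose r := e / (M + 1) / 2; have r0 : 0 < r by rewrite !divr_gt0.
  have [u zu] := near_j z r r0.
  apply: le_trans (ler_distD (L u) _ _) _.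
  apply: le_trans (_ : M * r + M * r <= _).
    rewrite lerD ?[`|L u - _|]distrC//.
      by apply: le_trans (Gy u) _; rewrite ler_wpM2l// ltW.
    by apply: le_trans (Gy' u) _; rewrite ler_wpM2l// ltW.
  by rewrite -mulrDr /r -splitr mulrCA ger_pMr// ler_pdivrMr// mul1r lerDl.
have Glin a z z' y y' : G z y -> G z' y' -> G (a *: z + z') (a *: y + y').
  move=> Gy Gy' u; apply/ler_addgt0Pr => e e0.
  pose b := `|a| + 1; have b0 : 0 < b by rewrite ltr_wpDl.
  pose r := e / (M + 1) / b / 2; have r0 : 0 < r by rewrite !divr_gt0.
  have [v zv] := near_j z r r0; have [v' zv'] := near_j z' r r0.
  have -> : a *: y + y' - L u =
      (a *: (y - L v) + (y' - L v')) + (L (a *: v + v') - L u).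
    rewrite (linearP L) scalerBr [in RHS]addrA; congr (_ - _).
    by rewrite (addrACA (a *: y)) -opprD subrK.
  apply: le_trans (ler_normD _ _) _.
  have E1 : `|a *: (y - L v) + (y' - L v')| <= M * (b * r).
    apply: le_trans (ler_normD _ _) _; rewrite normrZ mulrDl mul1r mulrDr lerD//.
      rewrite mulrCA ler_wpM2l//; apply: le_trans (Gy v) _.
      by rewrite ler_wpM2l// ltW.
    by apply: le_trans (Gy' v') _; rewrite ler_wpM2l// ltW.
  have E2 : `|L (a *: v + v') - L u| <= M * (`|a *: z + z' - j u| + b * r).
    apply: le_trans (LB _ _) _; rewrite ler_wpM2l// (linearP j).
    apply: le_trans (ler_distD (a *: z + z') _ _) _; rewrite [leRHS]addrC lerD2r.
    rewrite opprD addrACA -scalerBr.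
    apply: le_trans (ler_normD _ _) _; rewrite normrZ mulrDl mul1r lerD//.
      by rewrite ler_wpM2l// distrC ltW.
    by rewrite distrC ltW.
  apply: le_trans (lerD E1 E2) _; rewrite mulrDr addrCA lerD2l -mulrDr -mulrDr.
  rewrite /r -splitr ![b * _]mulrC divfK ?gt_eqF// mulrCA.
  by rewrite ger_pMr// ler_pdivrMr// mul1r lerDl.
have /choice[T GT] : forall z, exists y, G z y by [].
have Tlin : linear T.
  by move=> a u v; apply: Guniq (GT _) _; exact: Glin.
exists T; split=> //; last by move=> u; apply: Guniq (GT _) _.
pose f : {linear C -> Y} := HB.pack T (GRing.isLinear.Build _ _ _ _ T Tlin).
apply: (@linear_le_continuous _ _ _ f M) => // z.
by have := GT z 0; rewrite (linear0 L) (linear0 j) !subr0.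
Qed.

Section BoundedMultilinear.
Context (K : numFieldType) (d : nat) (X Y : normedModType K).
Context (T : ('I_d -> X) -> Y) (B : K).
Hypothesis Tlin : multilinear T.
Hypothesis TB : forall x, (forall i, `|x i| <= 1) -> `|T x| <= B.

Lemma multilinear_le (c : 'I_d -> K) (x : 'I_d -> X) :
  (forall i, 0 < c i) -> (forall i, `|x i| <= c i) -> `|T x| <= B * \prod_i c i.
Proof.
move=> c0 xc.
have -> : x = (fun i => c i *: ((c i)^-1 *: x i)).
  by apply/funext => i; rewrite scalerA divff ?scale1r ?gt_eqF.
rewrite (multilinear_scale Tlin) normrZ mulrC normr_prod.
rewrite (eq_bigr c) => [|i _]; last by rewrite gtr0_norm.
rewrite ler_wpM2r ?prodr_ge0// => [i _|]; first exact: ltW.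
apply: TB => i; rewrite normrZ gtr0_norm ?invr_gt0//.
by rewrite ler_pdivrMl// mulr1.
Qed.

(** Write [x = a + (x - a)] in each slot and expand: every term other than [T a] contains a small
    increment. *)
Lemma bounded_multilinear_continuous : continuous (T : {ptws 'I_d -> X} -> Y).
Proof.
move=> a; apply/(@cvgrPdist_le K Y _ (nbhs (a : {ptws 'I_d -> X}))) => e e0.
have B0 : 0 <= B.
  by apply: le_trans (TB (x := fun=> 0) _); rewrite ?normr_ge0// => i; rewrite normr0.
pose A := 1 + \sum_i `|a i|.
have A1 : 1 <= A by rewrite lerDl sumr_ge0.
have A0 : 0 < A by rewrite (lt_le_trans _ A1).
have aA i : `|a i| <= A.
  by rewrite /A (bigD1 i)//= addrCA lerDl addr_ge0// sumr_ge0.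
pose Q := B * A ^+ d *+ #|{ffun 'I_d -> bool}|.
have Q0 : 0 <= Q by rewrite mulrn_wge0// mulr_ge0// exprn_ge0// ltW.
have eQ : 0 < e + Q by rewrite ltr_pwDl.
(* This choice gives both [r <= 1] and [Q * r <= e], also when [Q = 0]. *)
pose r := e / (e + Q).
have r0 : 0 < r by rewrite divr_gt0.
have r1 : r <= 1 by rewrite ler_pdivrMr// mul1r lerDl.
have ar i : \forall x \near (a : {ptws 'I_d -> X}), `|a i - x i| <= r.
  have /(@cvgrPdist_le K X _ (nbhs (a : {ptws 'I_d -> X}))) :=
    @proj_continuous _ (fun=> X) i a.
  exact.
have axr : \forall x \near (a : {ptws 'I_d -> X}), forall i, `|a i - x i| <= r.
  exact: (@filter_forall {ptws 'I_d -> X} _ _ _ (nbhs_filter _) ar).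
apply: (@filterS _ (nbhs (a : {ptws 'I_d -> X})) _ _ _ _ axr) => x ax.
pose v i (b : bool) := if b then x i - a i else a i.
have -> : T x = T (fun i => \sum_b v i b).
  by congr T; apply/funext => i; rewrite big_bool /v/= subrK.
rewrite (multilinear_expand Tlin true v) (bigD1 [ffun=> false])//=.
rewrite (_ : (fun i => v i _) = a); last by apply/funext => i; rewrite ffunE.
rewrite opprD addrA subrr sub0r normrN.
apply: le_trans (ler_norm_sum _ _ _) _.
apply: le_trans (_ : Q * r <= _); last first.
  by rewrite /r mulrCA ger_pMr// ler_pdivrMr// mul1r lerDr ltW.
rewrite /Q mulrnAl -sumr_const [leRHS](bigD1 [ffun=> false])//=.
rewrite -[leLHS]add0r; apply: lerD.
  by rewrite mulr_ge0 ?(ltW r0)// mulr_ge0// exprn_ge0// ltW.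
apply: ler_sum => f f0.
have [i fi] : exists i, f i.
  apply/existsP; apply: contraR f0 => /existsPn fF.
  by apply/eqP/ffunP => i; rewrite ffunE; apply/negbTE.
(* Increments are at most [r <= A * r] since [1 <= A]. Slot [i] supplies one factor [r]; further
   increments cost nothing, as [A * r <= A]. *)
apply: le_trans (multilinear_le (c := fun i => if f i then A * r else A) _ _) _.
- by move=> k /=; case: (f k) => //; exact: mulr_gt0.
- move=> k; rewrite /v /=; case: (f k); last exact: aA.
  rewrite distrC.
  by apply: le_trans (ax k) _; rewrite ler_peMl// ltW.
rewrite -mulrA ler_wpM2l// (bigD1 i)//= fi -mulrA mulrCA [leRHS]mulrC.
rewrite ler_wpM2l ?(ltW r0)//.
rewrite (_ : A ^+ d = A * \prod_(k < d | k != i) A); last first.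
  by rewrite -(bigD1 i (P := predT) (F := fun=> A))//= prodr_const card_ord.
rewrite ler_wpM2l ?(ltW A0)//; apply: ler_prod => k _.
case: (f k); last by rewrite (ltW A0) lexx.
by rewrite ger_pMr// r1 mulr_ge0// ltW.
Qed.

End BoundedMultilinear.

(** * Lipschitz estimate for a reasonable cross norm *)

Section Polarization.
Context (K : numFieldType) (d : nat) (X : normedModType K).
Hypothesis d_gt0 : (0 < d)%N.

(** A subset sum of vectors of norm at most 1 has norm at most [d]; the other factors count the
    subsets and normalize [sym]. *)
Definition polar_const : K := (d`!)%:R^-1 * (d%:R ^+ d *+ #|{set 'I_d}|).

Lemma sym_le (Y : normedModType K) (L : {linear stensor d X -> Y}) (N : K) :
  0 <= N -> (forall x, `|L (tpow d x)| <= N * `|x| ^+ d) ->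
  forall x, (forall i, `|x i| <= 1) -> `|L (sym x)| <= polar_const * N.
Proof.
move=> N0 LN x x1; rewrite /sym linearZ/= normrZ normfV normr_nat -mulrA.
rewrite ler_wpM2l ?invr_ge0// linear_sum.
apply: le_trans (ler_norm_sum _ _ _) _.
rewrite -sumr_const mulr_suml; apply: ler_sum => J _.
rewrite linearZ/= normrZ normrX normrN1 expr1n mul1r.
apply: le_trans (LN _) _; rewrite mulrC ler_wpM2r// lerXn2r ?nnegrE//.
apply: le_trans (ler_norm_sum _ _ _) _.
apply: le_trans (_ : \sum_(j < d) 1 <= _).
  by rewrite big_mkcond/=; apply: ler_sum => j _; case: ifP.
by rewrite sumr_const card_ord.
Qed.

(* As 0^-1 = 0, unit 0 = 0, so that linearly dependent x and y need no separate
   treatment. *)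
Lemma exists_bounded_coordinates (x y : X) : norming K ->
  exists (e : bool -> X) (f : bool -> {linear X -> K^o}),
    [/\ forall b, `|e b| <= 1, forall b z, `|f b z| <= 2 * `|z|,
        x = \sum_b f b x *: e b & y = \sum_b f b y *: e b].
Proof.
move=> normingK.
pose unit (z : X) := `|z|^-1 *: z.
have unit_le z : `|unit z| <= 1.
  rewrite normrZ normfV normr_id; have [->|z0] := eqVneq z 0.
    by rewrite normr0 mulr0.
  by rewrite mulVf// normr_eq0.
have unitK z : `|z| *: unit z = z.
  rewrite scalerA; have [->|z0] := eqVneq z 0; first by rewrite scaler0.
  by rewrite divff ?scale1r// normr_eq0.
have [f1 [f1le f1x]] := normingK X x.
pose y' := y - f1 y *: unit x.
have [g [gle gy']] := normingK X y'.
(* [f2] is [g] after removing the component along [unit x]: it kills [x], takes at [y] the norm of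
   [y'], and has norm at most [1 + 1], whence the constant 2. *)
have f2lin : linear (fun z => g (z - f1 z *: unit x) : K^o).
  move=> a u v; rewrite -linearP; congr (g _).
  by rewrite (linearP f1) scalerDl scalerBr (scalerA a) opprD addrACA.

have [f2 f2E] : exists f2 : {linear X -> K^o},
    forall z, f2 z = g (z - f1 z *: unit x).
  by exists (HB.pack (fun z => g (z - f1 z *: unit x) : K^o)
    (GRing.isLinear.Build _ _ _ _ _ f2lin) : {linear _ -> _}).
exists (fun b => if b then unit x else unit y'), (fun b => if b then f1 else f2).
split.
- by case.
- case=> z; first by apply: le_trans (f1le z) _; rewrite ler_peMl// ler1n.
  rewrite f2E; apply: le_trans (gle _) _; apply: le_trans (ler_normB _ _) _.
  rewrite mulr_natl mulr2n lerD2l normrZ; apply: le_trans (f1le z).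
  by rewrite ler_piMr.
- by rewrite big_bool/= f2E f1x unitK subrr linear0 scale0r addr0.
- by rewrite big_bool/= f2E -/y' gy' unitK addrC subrK.
Qed.

End Polarization.

Lemma tens_functionalB (K : numFieldType) (d : nat) (X : lmodType K)
    (f : 'I_d -> {linear X -> K^o}) (u v : tensor d X) :
  tens_functional f (u - v) = tens_functional f u - tens_functional f v.
Proof.
by rewrite /tens_functional -[span_val (u - v)]/(\val (u - v)) raddfB.
Qed.

Section AlphaLipschitz.
Context (K : numFieldType) (d : nat) (X Y : normedModType K).
Context (alpha : tensor d X -> K).
Hypothesis d_gt0 : (0 < d)%N.
Hypothesis infK : inf_complete K.
Hypothesis normingK : norming K.
Hypothesis alpha_rcn : reasonable_cross_norm alpha.

(** [2 ^+ d] bounds a product of [d] coordinate functionals, [polar_const] the value of [L \o sym]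
    on unit vectors, and the multiplicity counts the words in the two basis vectors. *)
Definition alpha_const : K :=
  (2 ^+ d * polar_const K d) *+ #|{ffun 'I_d -> bool}|.

(* The difference of two pure powers lives in the tensor power of a
   two-dimensional space, on which alpha dominates all coordinates. *)
Lemma alpha_lipschitz (L : {linear stensor d X -> Y}) (N : K) :
  0 <= N -> (forall x, `|L (tpow d x)| <= N * `|x| ^+ d) ->
  forall x y, `|L (tpow d x) - L (tpow d y)| <= alpha_const * N *
    alpha (stensor_val (tpow d x) - stensor_val (tpow d y)).
Proof.
move=> N0 LN x y.
have [e [f [e1 f2 xE yE]]] := exists_bounded_coordinates x y normingK.
have Slin : multilinear (fun z => L (sym z)).
  by move=> z i a u v; rewrite (sym_multilinear d_gt0) linearP.
pose F (g : {ffun 'I_d -> bool}) (i : 'I_d) := f (g i).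
(* The coefficients depend on [z] only through its tensor power, so subtracting two expansions
   leaves functionals evaluated at the difference of the powers, where [rcn_functional] applies. *)
have expand z : z = \sum_b f b z *: e b -> L (tpow d z) =
    \sum_(g : {ffun 'I_d -> bool})
      tens_functional (F g) (stensor_val (tpow d z)) *: L (sym (fun i => e (g i))).
  move=> zE; transitivity (L (sym (fun=> \sum_b f b z *: e b))).
    by rewrite -zE sym_diag.
  rewrite (multilinear_expand Slin true (fun _ b => f b z *: e b)).
  apply: eq_bigr => g _.
  by rewrite [LHS](multilinear_scale Slin (fun i => f (g i) z) (fun i => e (g i))).
rewrite (expand x xE) (expand y yE) -sumrB.
apply: le_trans (ler_norm_sum _ _ _) _.
rewrite /alpha_const mulrnAl mulrnAl -sumr_const; apply: ler_sum => g _.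
rewrite -scalerBl normrZ -tens_functionalB; set a := alpha _.
apply: le_trans (_ : 2 ^+ d * a * (polar_const K d * N) <= _); last first.
  by rewrite mulrACA [a * N]mulrC mulrA.
apply: ler_pM => //; last exact: sym_le.
apply: le_trans (rcn_functional alpha_rcn (f := F g) _ _) _.
  by move=> i; apply: (linear_le_continuous (M := 2)) => // z; exact: f2.
rewrite ler_wpM2r ?(rcn_ge0 alpha_rcn)//.
rewrite -[in leRHS](card_ord d) -prodr_const; apply: ler_prod => i _.
have Fle z : `|z| <= 1 -> `|F g i z| <= 2.
  by move=> z1; apply: le_trans (f2 _ _) _; rewrite ler_piMr.
apply/andP; split; [exact: sup_norm_ge0 Fle|exact: sup_norm_le Fle].
Qed.

End AlphaLipschitz.

(** * The map [Psi] and its Lipschitz bounds *)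

Section PsiIsomorphism.
Context (K : numFieldType) (d : nat) (X Y : completeNormedModType K).
Context (C : s_pi_completion d X).
Hypothesis d_gt0 : (0 < d)%N.
Hypothesis infK : inf_complete K.
Hypothesis normingK : norming K.

(** Since [linearization] is picked by [xget], it suffices to exhibit one operator: the extension of
    the algebraic linearization to the completion. *)
Lemma linearizationP (P : X -> Y) : hpoly d P ->
  bounded_linear (C := C) (linearization P) /\
  forall x, P x = linearization (C := C) P (compl_inj C (tpow d x)).
Proof.
move=> hP; have [L LP] := stensor_linearization normingK hP.
have [M PM] := hpoly_bounded_ball d_gt0 hP.
have [|u|T [Tlin Tcont TL]] := @exists_bounded_extension _ _ C Y (compl_inj C) L
    (sup_norm P) (@compl_dense K d X C).
- exact: sup_norm_ge0 PM.
- by rewrite compl_isometry; exact: linearization_le.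
apply: (xgetPex 0 (P := [set T : C -> Y | bounded_linear T /\
  forall x, P x = T (compl_inj C (tpow d x))])).
by exists T; split=> // x; rewrite TL LP.
Qed.

Lemma veronese_powP (v : veronese d X) : exists x, v = veronese_pow d x.
Proof.
have [x _ xv] := set_valP v.
by exists x; apply: val_inj; rewrite /= -xv.
Qed.

Lemma Psi_pow (P : X -> Y) x : hpoly d P -> Psi C P (veronese_pow d x) = P x.
Proof. by move=> hP; rewrite (linearizationP hP).2. Qed.

Lemma hpoly_linear_comb (a : K) (P Q : X -> Y) :
  hpoly d P -> hpoly d Q -> hpoly d (a *: P + Q).
Proof.
move=> [S [Slin Scont PS]] [T [Tlin Tcont QT]].
exists (fun x => a *: S x + T x); split.
- move=> x i b u v; rewrite Slin Tlin !scalerDr !scalerA [a * b]mulrC.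
  by rewrite addrACA.
- move=> x; have Sx : S z @[z --> (x : {ptws 'I_d -> X})] --> S x by exact: Scont.
  have Tx : T z @[z --> (x : {ptws 'I_d -> X})] --> T x by exact: Tcont.
  exact: cvgD (cvgZl_tmp Sx) Tx.
- by move=> x; rewrite -PS -QT.
Qed.

Lemma Psi_linear : linear_on (@hpoly K d X Y) (@Psi K d X Y C).
Proof.
move=> a P Q hP hQ; apply/funext => v; have [x ->] := veronese_powP v.
rewrite Psi_pow; last exact: hpoly_linear_comb.
by rewrite -[RHS]/(a *: Psi C P _ + Psi C Q _) !Psi_pow.
Qed.

Lemma Psi_bij : set_bij (@hpoly K d X Y) (@v_operator K d X Y C) (@Psi K d X Y C).
Proof.
split.
- by move=> P hP; exists (linearization P) => //; exact: (linearizationP hP).1.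
- move=> P Q /set_mem hP /set_mem hQ PQ; apply/funext => x.
  by rewrite -(Psi_pow x hP) PQ Psi_pow.
move=> _ [T [Tlin Tcont] ->].
(* Surjectivity: the preimage of [T] is [x |-> T (x^d)], whose d-linear form is [L \o sym],
   continuous by the polarization bound. *)
pose T' : {linear C -> Y} := HB.pack T (GRing.isLinear.Build _ _ _ _ T Tlin).
pose L : {linear stensor d X -> Y} := T' \o compl_inj C.
have [M M0 TM] : exists2 M, 0 <= M & forall z, `|T z| <= M * `|z|.
  have T0 : {for 0, continuous T'} by exact: Tcont.
  have /linear_boundedP/pinfty_ex_gt0[M M0 TM] := continuous_linear_bounded 0 T0.
  by exists M => //; exact: ltW.
have LM x : `|L (tpow d x)| <= M * `|x| ^+ d.
  apply: le_trans (TM _) _; rewrite ler_wpM2l// compl_isometry.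
  exact: s_pi_tpow.
pose P x := L (tpow d x).
have hP : hpoly d P.
  have Slin : multilinear (fun z => L (sym z)).
    by move=> z i a u v; rewrite (sym_multilinear d_gt0) linearP.
  exists (fun z => L (sym z)); split=> //.
    exact: bounded_multilinear_continuous Slin (sym_le M0 LM).
  by move=> x; rewrite sym_diag.
exists P => //; apply/funext => v; have [x ->] := veronese_powP v.
by rewrite Psi_pow.
Qed.

Lemma Psi_lip_s_pi (P : X -> Y) : hpoly d P ->
  lip_consts (@dist_s_pi K d X) (Psi C P) (sup_norm P).
Proof.
move=> hP; have [L LP] := stensor_linearization normingK hP.
have [M PM] := hpoly_bounded_ball d_gt0 hP.
split=> [|u v]; first exact: sup_norm_ge0 PM.
have [x ->] := veronese_powP u; have [y ->] := veronese_powP v.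
rewrite !Psi_pow// -!LP -linearB; exact: linearization_le.
Qed.

(** Comparing a pure power with the zero tensor suffices. Keeping [dist] general lets the estimate
    serve both metrics. *)
Lemma sup_norm_le_lip (dist : veronese d X -> veronese d X -> K) (P : X -> Y) r :
  (forall x, dist (veronese_pow d x) (veronese0 d X) <= `|x| ^+ d) ->
  hpoly d P -> lip_consts dist (Psi C P) r -> sup_norm P <= r.
Proof.
move=> dist_le hP [r0 Pr]; apply: sup_norm_le => // x x1.
have := Pr (veronese_pow d x) (veronese0 d X).
rewrite !Psi_pow// (hpoly0 d_gt0 hP) subr0 => /le_trans; apply.
by apply: ler_piMr => //; apply: le_trans (dist_le x) _; rewrite exprn_ile1.
Qed.

Lemma dist_s_pi_le x :
  dist_s_pi (veronese_pow d x) (veronese0 d X) <= `|x| ^+ d.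
Proof.
by rewrite /dist_s_pi veronese0E// subr0; exact: s_pi_tpow.
Qed.

Context (alpha : tensor d X -> K).
Hypothesis alpha_rcn : reasonable_cross_norm alpha.

Lemma dist_alpha_le x :
  dist_of alpha (veronese_pow d x) (veronese0 d X) <= `|x| ^+ d.
Proof.
rewrite /dist_of veronese0E// (linear0 (@stensor_val K d X)) subr0.
apply: le_trans (rcn_tens alpha_rcn (fun=> x)) _.
by rewrite prodr_const card_ord.
Qed.

Lemma Psi_lip_alpha (P : X -> Y) : hpoly d P ->
  lip_consts (dist_of alpha) (Psi C P) (alpha_const K d * sup_norm P).
Proof.
move=> hP; have [L LP] := stensor_linearization normingK hP.
have [M PM] := hpoly_bounded_ball d_gt0 hP.
have P0 : 0 <= sup_norm P by exact: sup_norm_ge0 PM.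
split=> [|u v].
  rewrite mulr_ge0// mulrn_wge0// mulr_ge0 ?exprn_ge0//.
  by rewrite mulr_ge0 ?invr_ge0// mulrn_wge0// exprn_ge0.
have [x ->] := veronese_powP u; have [y ->] := veronese_powP v.
rewrite !Psi_pow// -!LP; apply: alpha_lipschitz => // z.
by rewrite LP; exact: hpoly_le.
Qed.

End PsiIsomorphism.

Theorem proposition3p2 (R : realType) (K : numFieldType)
    (hK : K = (R : numFieldType) \/ K = (R[i] : numFieldType))
    (X Y : completeNormedModType K) (d : nat) (hd : (0 < d)%N)
    (C : s_pi_completion d X)
    (alpha : tensor d X -> K) (halpha : reasonable_cross_norm alpha) :
  [/\ isometric_isomorphism (polySpace d X Y) (VSpace Y C (@dist_s_pi K d X))
        (@Psi K d X Y C),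
      isomorphism (polySpace d X Y) (VSpace Y C (dist_of alpha))
        (@Psi K d X Y C)
    & isometric_inclusion (VSpace Y C (dist_of alpha))
        (Lip0 Y (dist_of alpha) (veronese0 d X)) (fun f => f)].
Proof.
have infK : inf_complete K.
  by case: hK => ->; [exact: inf_complete_real|exact: inf_complete_complex].
have normingK : norming K.
  by case: hK => ->; [exact: norming_real|exact: norming_complex].
have Plin := Psi_linear C hd infK normingK.
have Pbij := Psi_bij Y C hd infK normingK.
have alpha_lip := Psi_lip_alpha C hd infK normingK halpha.
split.
(* [sup_norm P] is itself a Lipschitz constant for [dist_s_pi], and the least one. *)
- split; [exact: Plin|exact: Pbij|move=> P hP; apply: infimum_min].
    exact: Psi_lip_s_pi.
  by move=> r; apply: sup_norm_le_lip => // x; exact: dist_s_pi_le.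
- split; [exact: Plin|exact: Pbij| |].
    exists (alpha_const K d) => P hP; apply: infimum_lb => //; last exact: alpha_lip.
    by move=> r [].
  exists 1 => P hP; rewrite mul1r; apply: infimum_glb => //.
  + by exists (alpha_const K d * sup_norm P); exact: alpha_lip.
  + by move=> r [].
  + by move=> r; apply: sup_norm_le_lip => // x; exact: dist_alpha_le.
(* Both spaces carry the same [lip_norm], so only membership in [Lip0] remains; by surjectivity [f]
   is some [Psi C P], which is Lipschitz for [dist_of alpha] and vanishes at the base point. *)
- split=> // f Vf; have [_ _ /(_ f Vf)[P hP <-]] := Pbij; split.
    by exists (alpha_const K d * sup_norm P); exact: alpha_lip.
  by rewrite Psi_pow// (hpoly0 hd hP).
Qed.
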